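(* Let $\{\lambda_1,\ldots,\lambda_n\}$ and $\{\mu_1,\ldots,\mu_{n-1}\}$ be two systems of complex numbers. Consider, for $\alpha\in\mathbb{C}$ and $k\in\{1,\ldots,n-1\}$, the condition $$C_k(\{\mu_j-\alpha\}_{j=1}^{n-1})\prec_{uds} C_k(\{\lambda_j-\alpha\}_{j=1}^{n}).\qquad ( * )$$ For the existence of a normal matrix $A\in M_n(\mathbb{C})$ such that $\sigma(A)=\{\lambda_1,\ldots,\lambda_n\}$ and $\sigma(A_{n-1})=\{\mu_1,\ldots,\mu_{n-1}\}$ it is necessary that $( * )$ be fulfilled for every $\alpha\in\mathbb{C}$ and every $k\in\{1,\ldots,n-1\}$, and sufficient that $( * )$ be fulfilled for $k=n-1$ and all $\alpha\in\{\lambda_1,\ldots,\lambda_n\}$.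
   Context: For an $n\times n$ matrix $A$, $A_{n-1}$ is the principal $(n-1)\times(n-1)$ submatrix obtained by deleting the last row and column. $\sigma(\cdot)$ is the spectrum, with eigenvalues listed according to algebraic multiplicity. For a vector $\{z_j\}_{j=1}^m\in\mathbb{C}^m$ and $1\le k\le m$, $C_k(\{z_j\}_{1}^m):=\{z_{i_1}\cdots z_{i_k}\}_{1\le i_1<\ldots<i_k\le m}\in\mathbb{C}^{\binom{m}{k}}$ is the vector of all products of $k$ entries with increasing indices. A matrix $S\in M_m(\mathbb{R})$ is unitary-stochastic if there is a unitary $U=(u_{ij})\in M_m(\mathbb{C})$ with $S=U\circ\overline{U}$ (entrywise product), i.e. $s_{ij}=|u_{ij}|^2$. For finite sequences of complex numbers $x=\{x_j\}_{j=1}^l$ and $y=\{y_j\}_{j=1}^m$ with $l\le m$, $x\prec_{uds}y$ means: there exist complex numbers $x_{l+1},\ldots,x_m$ and a unitary-stochastic matrix $S\in M_m(\mathbb{R})$ such that $(x_1,\ldots,x_m)^T=S(y_1,\ldots,y_m)^T$.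
   Formalization: Sufficiency is stated only for pairwise distinct λ_1,…,λ_n; with repeated λ_j it is false as written (e.g. λ=(0,0,0), μ=(0,1) satisfies ( * ) for k=2, α=0, but A must be 0). Necessity is unrestricted. *)

(* Defs.v *)
From HB Require Import structures.
From mathcomp Require Import all_boot all_order all_algebra.
From mathcomp Require Import reals complex.

Set Implicit Arguments.
Unset Strict Implicit.
Unset Printing Implicit Defensive.

Import Order.TTheory GRing.Theory Num.Theory.
Local Open Scope ring_scope.
Local Open Scope complex_scope.

(* An increasing index tuple i_1 < ... < i_k in 'I_m is encoded by the k-subset
   {i_1, ..., i_k}.  The entries of [Ck k z] follow the enumeration order of
   these subsets; [uds_prec] does not depend on the order of the entries of its
   two arguments. *)
Definition ksubsets (m k : nat) : {set {set 'I_m}} :=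
  [set I : {set 'I_m} | #|I| == k].

Lemma card_ksubsets (m k : nat) : #|ksubsets m k| = 'C(m, k).
Proof. by rewrite card_draws card_ord. Qed.

Definition Ck (R : realType) (m k : nat) (z : 'I_m -> R[i]) :
    'I_#|ksubsets m k| -> R[i] :=
  fun a => \prod_(i in (enum_val a : {set 'I_m})) z i.
Arguments Ck {R m} k z _.

Definition unitary_stochastic (R : realType) (m : nat) (S : 'M[R]_m) : Prop :=
  exists2 U : 'M[R[i]]_m, U \is unitarymx &
    forall i j, (S i j)%:C = U i j * (U i j)^*%R.

(* x' is x extended by arbitrary complex numbers x_{l+1}, ..., x_m. *)
Definition uds_prec (R : realType) (l m : nat)
    (x : 'I_l -> R[i]) (y : 'I_m -> R[i]) : Prop :=
  (l <= m)%N /\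
  exists (x' : 'I_m -> R[i]) (S : 'M[R]_m),
    [/\ forall (i : 'I_l) (j : 'I_m), i = j :> nat -> x' j = x i,
        unitary_stochastic S
      & \col_j x' j = map_mx (real_complex R) S *m \col_j y j].

(* The eigenvalues of A, with algebraic multiplicity, are the entries of z. *)
Definition has_spectrum (R : realType) (n : nat) (A : 'M[R[i]]_n)
    (z : 'I_n -> R[i]) : Prop :=
  char_poly A = \prod_(j < n) ('X - (z j)%:P).

Definition principal_submx (R : realType) (n : nat) (A : 'M[R[i]]_n.+1) :
    'M[R[i]]_n :=
  row' ord_max (col' ord_max A).

Definition normal_realizes (R : realType) (n : nat) (A : 'M[R[i]]_n.+1)
    (lambda : 'I_n.+1 -> R[i]) (mu : 'I_n -> R[i]) : Prop :=
  [/\ A \is normalmx, has_spectrum A lambda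
    & has_spectrum (principal_submx A) mu].

Definition Ck_uds (R : realType) (n : nat)
    (lambda : 'I_n.+1 -> R[i]) (mu : 'I_n -> R[i])
    (alpha : R[i]) (k : nat) : Prop :=
  uds_prec (Ck k (fun j => mu j - alpha)) (Ck k (fun j => lambda j - alpha)).

(* Main.v *)
(* Necessity.  Write A = U D U^* with D = diag(lambda), and let V triangularize
   A_(n-1) unitarily, V A_(n-1) V^* = T.  With G = V U', U' being U without its
   last row, G has orthonormal rows and T - alpha = G (D - alpha) G^*.  By
   Cauchy-Binet, taking k-th compounds (matrices of k x k minors) is
   multiplicative, so C_k(G) has orthonormal rows too, and comparing the
   diagonals of C_k(T - alpha) = C_k(G) C_k(D - alpha) C_k(G)^* expresses
   C_k(mu - alpha) through C_k(lambda - alpha) with coefficients |C_k(G)_ab|^2.  Completing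
   C_k(G) to a unitary matrix gives the unitary-stochastic matrix.

   Sufficiency.  For alpha = lambda_j and k = n-1 only one entry of
   C_k(lambda - alpha) can be nonzero, so the hypothesis says
   prod_i (mu_i - lambda_j) = w_j prod_(i <> j) (lambda_i - lambda_j) with w_j >= 0.
   Lagrange interpolation gives
   prod_i (X - mu_i) = sum_j w_j prod_(i <> j) (X - lambda_i), hence sum_j w_j = 1.
   If U is unitary with last row (sqrt w_j)_j, the last diagonal entry of the
   adjugate of X - U D U^* is exactly this sum. *)

Require Import Defs.
From mathcomp Require Import all_boot all_order all_algebra.
From mathcomp Require Import reals complex.
From mathcomp Require Import perm spectral.

Import Order.TTheory GRing.Theory Num.Theory.
Local Open Scope ring_scope.
Local Open Scope sesquilinear_scope.

(** * Subsets of size k and their increasing enumeration *)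

Lemma card_ksubset (m k : nat) (a : 'I_#|ksubsets m k|) :
  k = #|(enum_val a : {set 'I_m})|.
Proof. by have := enum_valP a; rewrite inE => /eqP. Qed.

Definition ksubset_nth (m k : nat) (a : 'I_#|ksubsets m k|) (i : 'I_k) : 'I_m :=
  enum_val (cast_ord (card_ksubset m k a) i).
Arguments ksubset_nth {m k} a i.

Lemma ksubset_nth_inj (m k : nat) (a : 'I_#|ksubsets m k|) :
  injective (ksubset_nth a).
Proof. by move=> i j /enum_val_inj /cast_ord_inj. Qed.

Lemma ksubset_nth_in (m k : nat) (a : 'I_#|ksubsets m k|) (i : 'I_k) :
  ksubset_nth a i \in (enum_val a : {set 'I_m}).
Proof. exact: enum_valP. Qed.

Lemma imset_ksubset_nth (m k : nat) (a : 'I_#|ksubsets m k|) :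
  ksubset_nth a @: 'I_k = enum_val a.
Proof.
apply/eqP; rewrite eqEcard card_imset; last exact: ksubset_nth_inj.
rewrite card_ord -card_ksubset leqnn andbT.
by apply/subsetP => _ /imsetP[i _ ->]; exact: ksubset_nth_in.
Qed.

(** [enum] filters the increasing list of ordinals. Monotonicity is what keeps the principal
    submatrices of a triangular matrix triangular in [compound_trig]. *)
Lemma ksubset_nth_lt (m k : nat) (a : 'I_#|ksubsets m k|) (i j : 'I_k) :
  (i < j)%N -> (ksubset_nth a i < ksubset_nth a j)%N.
Proof.
move=> lt_ij; rewrite /ksubset_nth !(enum_val_nth (ksubset_nth a i)) /=.
set s := enum _; set x0 := ksubset_nth a i.
have lts l : (l < k)%N -> (l < size s)%N by rewrite /s -cardE -card_ksubset.
have lt_s l : (l < k)%N -> nth x0 s l = nth 0%N (map val s) l :> nat.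
  by move=> /lts ltl; rewrite (nth_map x0).
rewrite !lt_s //.
have sorted_s : sorted ltn (map val s).
  rewrite /s /enum_mem -enumT sorted_map sorted_filter //.
    by move=> x y z; exact: ltn_trans.
  by rewrite -sorted_map val_enum_ord iota_ltn_sorted.
by apply: (sorted_ltn_nth ltn_trans) => //; rewrite inE size_map; exact: lts.
Qed.

Lemma big_ksubset_nth (R : Type) (idx : R) (op : Monoid.com_law idx) (m k : nat)
    (a : 'I_#|ksubsets m k|) (F : 'I_m -> R) :
  \big[op/idx]_(i < k) F (ksubset_nth a i) =
  \big[op/idx]_(i in (enum_val a : {set 'I_m})) F i.
Proof.
by rewrite -imset_ksubset_nth big_imset //= => i j _ _; exact: ksubset_nth_inj.
Qed.

(** * Compound matrices and the Cauchy-Binet formula *)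

Definition compound_mx (K : comNzRingType) (k m n : nat) (A : 'M[K]_(m, n)) :
    'M[K]_(#|ksubsets m k|, #|ksubsets n k|) :=
  \matrix_(a, b) \det (mxsub (ksubset_nth a) (ksubset_nth b) A).
Arguments compound_mx {K} k {m n} A.

Lemma trmx_compound (K : comNzRingType) (k m n : nat) (A : 'M[K]_(m, n)) :
  (compound_mx k A)^T = compound_mx k A^T.
Proof. by apply/matrixP=> a b; rewrite !mxE -det_tr trmx_mxsub. Qed.

Lemma map_compound (K K' : comNzRingType) (f : {rmorphism K -> K'})
    (k m n : nat) (A : 'M[K]_(m, n)) :
  map_mx f (compound_mx k A) = compound_mx k (map_mx f A).
Proof. by apply/matrixP=> a b; rewrite !mxE -det_map_mx map_mxsub. Qed.

(** In the Leibniz formula each factor is a sum over a middle index; distributing the product means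
    choosing one index [f i] per row. *)
Lemma det_mulmx_sum_ffun (K : comNzRingType) (k n : nat)
    (A : 'M[K]_(k, n)) (B : 'M[K]_(n, k)) :
  \det (A *m B) =
  \sum_(f : {ffun 'I_k -> 'I_n}) (\prod_i A i (f i)) * \det (rowsub f B).
Proof.
transitivity (\sum_(f : {ffun 'I_k -> 'I_n}) \sum_(s : 'S_k)
    (-1) ^+ s * \prod_i (A i (f i) * B (f i) (s i))).
  rewrite exchange_big; apply: eq_bigr => /= s _; rewrite -big_distrr /=.
  congr (_ * _); rewrite -(bigA_distr_bigA (fun i j => A i j * B j (s i))) /=.
  by apply: eq_bigr => i _; rewrite mxE.
apply: eq_bigr => f _; rewrite big_distrr /=; apply: eq_bigr => s _.
rewrite mulrCA big_split /=; congr (_ * (_ * _)).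
by apply: eq_bigr => i _; rewrite mxE.
Qed.

(* Only injective f contribute, and these are the enumerations of k-subsets
   composed with permutations. *)
Lemma cauchy_binet (K : comNzRingType) (k n : nat)
    (A : 'M[K]_(k, n)) (B : 'M[K]_(n, k)) :
  \det (A *m B) = \sum_(c < #|ksubsets n k|)
    \det (colsub (ksubset_nth c) A) * \det (rowsub (ksubset_nth c) B).
Proof.
rewrite det_mulmx_sum_ffun.
rewrite (bigID (fun f : {ffun 'I_k -> 'I_n} => f @: 'I_k \in ksubsets n k)) /=.
rewrite addrC big1 ?add0r => [|f]; last first.
  rewrite inE => im_f.
  have /injectivePn[i [j neq_ij eq_f]] : ~~ injectiveb f.
    apply: contra im_f => /injectiveP inj_f.
    by rewrite card_imset // card_ord.
  rewrite (determinant_alternate neq_ij) ?mulr0 // => l.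
  by rewrite !mxE eq_f.
rewrite (partition_big (fun f : {ffun 'I_k -> 'I_n} => f @: 'I_k)
  (mem (ksubsets n k))) //= big_enum_val /=; apply: eq_bigr => c _.
(* The maps with image the subset [c] are parametrized by permutations through [h], with inverse
   [h']. The default value 1 is never reached on such maps. *)
pose h (s : 'S_k) := [ffun i => ksubset_nth c (s i)].
pose h' (f : {ffun 'I_k -> 'I_n}) := odflt 1%g [pick s | h s == f].
have h_inj : injective h.
  move=> s t /ffunP eq_st; apply/permP => i; apply: (@ksubset_nth_inj _ _ c).
  by have := eq_st i; rewrite !ffunE.
rewrite (reindex_onto h h') => [|f /andP[_ /eqP im_f]]; last first.
  rewrite /h'; case: pickP => [s /eqP //|no_s].
  have /fin_all_exists[s0 s0P] i : exists j, ksubset_nth c j = f i.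
    have : f i \in ksubset_nth c @: 'I_k.
      by rewrite imset_ksubset_nth -im_f imset_f.
    by case/imsetP=> j _ ->; exists j.
  have inj_s0 : injective s0.
    have inj_f : {in 'I_k &, injective f}.
      by apply/imset_injP; rewrite im_f -card_ksubset card_ord.
    by move=> i j eq_ij; apply: inj_f => //; rewrite -!s0P eq_ij.
  have /eqP[] := no_s (perm inj_s0).
  by apply/ffunP => i; rewrite ffunE permE.
rewrite (eq_bigl xpredT) => [|s]; last first.
  have -> : h' (h s) = s.
    by rewrite /h'; case: pickP => [t /eqP/h_inj //|/(_ s)]; rewrite eqxx.
  have -> : h s @: 'I_k = enum_val c.
    rewrite -imset_ksubset_nth; apply/setP => x; apply/imsetP/imsetP.
      by case=> i _ ->; exists (s i); rewrite ?ffunE.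
    by case=> i _ ->; exists (s^-1%g i); rewrite ?ffunE ?permKV.
  by rewrite !eqxx enum_valP.
rewrite [\det (colsub _ _)]/determinant big_distrl /=.
apply: eq_bigr => s _.
have -> : rowsub (h s) B = row_perm s (rowsub (ksubset_nth c) B).
  by apply/matrixP => i j; rewrite !mxE ffunE.
rewrite row_permE det_mulmx det_perm mulrA; congr (_ * _).
by rewrite mulrC; congr (_ * _); apply: eq_bigr => i _; rewrite !mxE ffunE.
Qed.

Lemma compound_mulmx (K : comNzRingType) (k m n p : nat)
    (A : 'M[K]_(m, n)) (B : 'M[K]_(n, p)) :
  compound_mx k (A *m B) = compound_mx k A *m compound_mx k B.
Proof.
apply/matrixP => a b; rewrite !mxE mxsub_mul cauchy_binet.
by apply: eq_bigr => c _; rewrite !mxE -!mxsub_comp.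
Qed.

Lemma compound_diag (K : comNzRingType) (k n : nat) (d : 'rV[K]_n) :
  compound_mx k (diag_mx d) =
  diag_mx (\row_a \prod_(i in (enum_val a : {set 'I_n})) d 0 i).
Proof.
apply/matrixP => a b; rewrite !mxE; have [->|neq_ab] := eqVneq a b.
  rewrite mulr1n -big_ksubset_nth.
  have -> : mxsub (ksubset_nth b) (ksubset_nth b) (diag_mx d) =
            diag_mx (\row_i d 0 (ksubset_nth b i)).
    by apply/matrixP=> i j; rewrite !mxE (inj_eq (@ksubset_nth_inj _ _ b)).
  by rewrite det_diag; apply: eq_bigr => i _; rewrite mxE.
rewrite mulr0n /determinant big1 // => s _.
(* Distinct subsets of equal size: some x lies in the first but not in the second, and the row of
   the minor at x vanishes. *)
have /subsetPn[x] : ~~ ((enum_val a : {set 'I_n}) \subset enum_val b).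
  apply: contra neq_ab => sub_ab; apply/eqP/enum_val_inj/eqP.
  by rewrite eqEcard sub_ab -!card_ksubset leqnn.
rewrite -[enum_val a]imset_ksubset_nth => /imsetP[i _ ->] notin_b.
rewrite (bigD1 i) //= !mxE; case: eqP => [eq_ab|_]; last by rewrite mul0r mulr0.
by case/negP: notin_b; rewrite eq_ab ksubset_nth_in.
Qed.

Lemma compound1 (K : comNzRingType) (k n : nat) :
  compound_mx k (1%:M : 'M[K]_n) = 1%:M.
Proof.
rewrite -!diag_const_mx compound_diag; congr diag_mx; apply/rowP => a.
by rewrite !mxE; apply: big1 => i _; rewrite mxE.
Qed.

Lemma compound_trig (K : comNzRingType) (k n : nat) (T : 'M[K]_n)
    (a : 'I_#|ksubsets n k|) :
  is_trig_mx T ->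
  compound_mx k T a a = \prod_(i in (enum_val a : {set 'I_n})) T i i.
Proof.
move=> /is_trig_mxP trigT; rewrite mxE det_trig.
  by rewrite -big_ksubset_nth; apply: eq_bigr => i _; rewrite mxE.
by apply/is_trig_mxP => i j lt_ij; rewrite mxE trigT ?ksubset_nth_lt.
Qed.

Lemma compound_unitary (C : numClosedFieldType) (k m n : nat)
    (A : 'M[C]_(m, n)) :
  A \is unitarymx -> compound_mx k A \is unitarymx.
Proof.
move=> /unitarymxP AA1; apply/unitarymxP.
by rewrite trmx_compound map_compound -compound_mulmx AA1 compound1.
Qed.

(** * Unitary completion, diagonalization and triangularization *)

Lemma unitarymx_completion (C : numClosedFieldType) (m n : nat)
    (G : 'M[C]_(m, n)) :
  G \is unitarymx ->
  exists2 W : 'M[C]_n, W \is unitarymx &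
    forall (i : 'I_m) (j : 'I_n), i = j :> nat -> row j W = row i G.
Proof.
(* [W0] stacks G on an orthonormal basis, obtained by Gram-Schmidt, of the orthogonal complement of
   its row space. *)
move=> Gu; pose O := orthomx Num.conj (mx_of_hermitian (hermitian1mx _)) G.
pose W0 := col_mx G (schmidt (row_base O)).
have dimW0 : (m + \rank O = n)%N.
  by rewrite -[in LHS](mxrank_unitary Gu) add_rank_ortho.
have W0u : W0 \is unitarymx.
  apply/unitarymxP; rewrite tr_col_mx map_row_mx mul_col_row.
  rewrite !(unitarymxP _) ?schmidt_unitarymx ?rank_leq_col //.
  have GO : (G <= orthomx Num.conj (mx_of_hermitian (hermitian1mx _))
                     (schmidt (row_base O)))%MS.
    by rewrite orthomx_sym eqmx_schmidt_free ?eq_row_base ?row_base_free.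
  rewrite !(orthomx1P _) -?scalar_mx_block //.
  by rewrite orthomx_sym.
have usubW0 : usubmx W0 = G by rewrite col_mxKu.
clearbody W0; move: (\rank O) dimW0 W0 W0u usubW0 => r dimW0; clear O.
subst n => W0 W0u usubW0; exists W0 => // i j eq_ij.
have -> : j = lshift r i by exact/val_inj.
by rewrite -usubW0; apply/rowP => l; rewrite !mxE.
Qed.

Lemma char_poly_unitary_conj (C : numClosedFieldType) (n : nat)
    (P A : 'M[C]_n) :
  P \is unitarymx -> char_poly (P *m A *m P^t*) = char_poly A.
Proof.
move=> /unitarymxP PP1; rewrite /char_poly.
have mPP1 : map_mx polyC P *m map_mx polyC (P^t*) = 1%:M.
  by rewrite -map_mxM PP1 map_mx1.
have -> : char_poly_mx (P *m A *m P^t*) =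
    map_mx polyC P *m char_poly_mx A *m map_mx polyC (P^t*).
  rewrite /char_poly_mx !map_mxM mulmxBr mulmxBl; congr (_ - _).
  by rewrite scalar_mxC -mulmxA mPP1 mulmx1.
by rewrite !det_mulmx mulrAC -det_mulmx mPP1 det1 mul1r.
Qed.

Lemma prod_XsubC_perm (F : fieldType) (n : nat) (x y : 'I_n -> F) :
  \prod_j ('X - (x j)%:P) = \prod_j ('X - (y j)%:P) ->
  exists s : 'S_n, forall i, x i = y (s i).
Proof.
move=> eq_xy.
have /tuple_permP[s eq_s] :
    perm_eq [tuple x i | i < n] [tuple y i | i < n].
  by apply: prod_XsubC_eq; rewrite !big_map -!enumT !big_enum.
exists s => i.
have := congr1 (fun t : seq F => nth 0 t i) eq_s.
by rewrite -!tnth_nth !tnth_mktuple.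
Qed.


Lemma normalmx_diagonalization (C : numClosedFieldType) (n : nat)
    (A : 'M[C]_n) (z : 'I_n -> C) :
  A \is normalmx -> char_poly A = \prod_j ('X - (z j)%:P) ->
  exists2 U : 'M[C]_n, U \is unitarymx &
    A = U *m diag_mx (\row_j z j) *m U^t*.
Proof.
move=> /orthomx_spectralP Aspec charA.
set P := spectralmx A in Aspec; set d := spectral_diag A in Aspec.
have Pu : P \is unitarymx := spectral_unitarymx A.
have PtCu : P^t* \is unitarymx by rewrite trmxC_unitary.
rewrite invmx_unitary // in Aspec.
have [s zs] : exists s : 'S_n, forall i, d 0 i = z (s i).
  apply: prod_XsubC_perm; rewrite -charA Aspec -{2}[P]trmxCK.
  rewrite char_poly_unitary_conj // char_poly_trig ?diag_mx_is_trig //.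
  by apply: eq_bigr => j _; rewrite !mxE eqxx.
pose Q := row_perm s^-1 P.
have Qu : Q \is unitarymx.
  rewrite /Q row_permE mul_unitarymx //; apply/unitarymxP.
  by rewrite tr_perm_mx map_perm_mx -perm_mxM mulgV perm_mx1.
exists (Q^t*); first by rewrite trmxC_unitary.
rewrite trmxCK Aspec; apply/matrixP => i j.
rewrite !mxE (reindex_perm s^-1); apply: eq_bigr => l _.
by rewrite !mul_mx_diag !mxE zs permKV.
Qed.

Lemma unitary_triangularization (C : numClosedFieldType) (n : nat)
    (A : 'M[C]_n) (z : 'I_n -> C) :
  char_poly A = \prod_j ('X - (z j)%:P) ->
  exists (V : 'M[C]_n) (s : 'S_n), [/\ V \is unitarymx,
    is_trig_mx (V *m A *m V^t*) & forall i, (V *m A *m V^t*) i i = z (s i)].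
Proof.
case: n => [|n] in A z * => charA.
  exists 1%:M, 1%g; split; last by case.
    by apply/unitarymxP; apply/matrixP => -[].
  by apply/is_trig_mxP => -[].
have [V Vu simA] := Schur A isT.
have trigA : is_trig_mx (V *m A *m V^t*).
  by move: simA; rewrite /similar_to conjymx.
have [s zs] : exists s : 'S_n.+1, forall i, (V *m A *m V^t*) i i = z (s i).
  apply: prod_XsubC_perm; rewrite -charA -(char_poly_unitary_conj _ _ V) //.
  by rewrite char_poly_trig.
by exists V, s.
Qed.

Lemma rowsub_unitary (C : numClosedFieldType) (l m n : nat)
    (f : 'I_l -> 'I_m) (A : 'M[C]_(m, n)) :
  injective f -> A \is unitarymx -> rowsub f A \is unitarymx.
Proof.
move=> inj_f /unitarymxP AA1; apply/unitarymxP.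
rewrite trmx_mxsub map_mxsub -mxsub_mul AA1.
by apply/matrixP => i j; rewrite !mxE (inj_eq inj_f).
Qed.

Lemma uds_prec_isometry (R : realType) (l m : nat) (H : 'M[R[i]]_(l, m))
    (x : 'I_l -> R[i]) (y : 'I_m -> R[i]) :
  H \is unitarymx ->
  (forall i, x i = (H *m diag_mx (\row_j y j) *m H^t*) i i) ->
  uds_prec x y.
Proof.
move=> Hu xE; split; first by rewrite -(mxrank_unitary Hu) rank_leq_col.
have [W Wu WH] := unitarymx_completion _ _ _ _ Hu.
pose S : 'M[R]_m := \matrix_(i, j) complex.Re (W i j * (W i j)^*).
have SE i j : (S i j)%:C%C = W i j * (W i j)^*.
  by rewrite mxE RRe_real // ger0_real // mul_conjC_ge0.
exists (fun i => \sum_j (S i j)%:C%C * y j), S; split; last 1 first.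
- by apply/colP => i; rewrite !mxE; apply: eq_bigr => j _; rewrite !mxE.
- move=> i j eq_ij; rewrite xE !mxE; apply: eq_bigr => c _.
  rewrite mul_mx_diag SE !mxE.
  by have /rowP/(_ c) := WH _ _ eq_ij; rewrite !mxE => ->; rewrite mulrAC.
- by exists W.
Qed.

Lemma normal_realizes_Ck_uds (R : realType) (n : nat) (A : 'M[R[i]]_n.+1)
    (lambda : 'I_n.+1 -> R[i]) (mu : 'I_n -> R[i]) (alpha : R[i]) (k : nat) :
  normal_realizes A lambda mu -> Ck_uds lambda mu alpha k.
Proof.
case=> nA specA specA'.
have [U Uu AE] := normalmx_diagonalization _ _ _ _ nA specA.
have [V [s [Vu trigT diagT]]] := unitary_triangularization _ _ _ _ specA'.
pose G := V *m rowsub (lift ord_max) U.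
have Gu : G \is unitarymx.
  by rewrite mul_unitarymx // rowsub_unitary //; exact: lift_inj.
have TE : V *m principal_submx A *m V^t* =
    G *m diag_mx (\row_j lambda j) *m G^t*.
  have -> : principal_submx A = mxsub (lift ord_max) (lift ord_max) A.
    by apply/matrixP => i j; rewrite !mxE.
  rewrite AE mxsub_mul -mul_rowsub_mx /G trmx_mul map_mxM !mulmxA.
  by rewrite trmx_mxsub map_mxsub.
set T := V *m _ *m _ in trigT diagT TE.
clearbody T G.
have TaE : T - alpha%:M = G *m diag_mx (\row_j (lambda j - alpha)) *m G^t*.
  have -> : diag_mx (\row_j (lambda j - alpha)) =
            diag_mx (\row_j lambda j) - alpha%:M.
    by apply/matrixP => i j; rewrite !mxE mulrnBl.
  by rewrite mulmxBr mulmxBl -TE scalar_mxC -mulmxA (unitarymxP Gu) mulmx1.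
have trigTa : is_trig_mx (T - alpha%:M).
  move/is_trig_mxP: trigT => trigT; apply/is_trig_mxP => i j lt_ij.
  by rewrite !mxE trigT // -val_eqE /= (ltn_eqF lt_ij) subrr.
have sV (a : 'I_#|ksubsets n k|) :
    s^-1%g @: (enum_val a : {set 'I_n}) \in ksubsets n k.
  by rewrite inE card_imset; [rewrite -card_ksubset | exact: perm_inj].
pose f (a : 'I_#|ksubsets n k|) :=
  enum_rank_in (enum_valP a) (s^-1%g @: (enum_val a : {set 'I_n})).
have fE (a : 'I_#|ksubsets n k|) :
    enum_val (f a) = s^-1%g @: (enum_val a : {set 'I_n}).
  by apply: enum_rankK_in; exact: sV.
have inj_f : injective f.
  move=> a b /(congr1 enum_val); rewrite !fE.
  by move/(imset_inj (@perm_inj _ _)); exact: enum_val_inj.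
apply: (@uds_prec_isometry _ _ _ (rowsub f (compound_mx k G))).
  by rewrite rowsub_unitary // compound_unitary.
move=> a; transitivity (compound_mx k (T - alpha%:M) (f a) (f a)).
  rewrite compound_trig // fE /Ck big_imset /=; last first.
    by move=> ? ? _ _; exact: perm_inj.
  by apply: eq_bigr => i _; rewrite !mxE eqxx diagT permKV mulr1n.
rewrite TaE !compound_mulmx compound_diag -map_compound -trmx_compound.
rewrite trmx_mxsub map_mxsub mul_rowsub_mx -mxsub_mul [RHS]mxE.
congr ((_ *m diag_mx _ *m _) _ _); apply/rowP => b; rewrite !mxE.
by apply: eq_bigr => i _; rewrite mxE.
Qed.

Lemma Ck_uds_weight (R : realType) (n : nat)
    (lambda : 'I_n.+1 -> R[i]) (mu : 'I_n -> R[i]) (j : 'I_n.+1) :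
  Ck_uds lambda mu (lambda j) n ->
  exists2 w : R[i], 0 <= w &
    \prod_i (mu i - lambda j) = w * \prod_i (lambda (lift j i) - lambda j).
Proof.
case=> leq_card [x' [S [x'E [U Uu SE] x'S]]].
have setT_in : [set: 'I_n] \in ksubsets n n by rewrite inE cardsT card_ord.
pose i0 := enum_rank_in setT_in setT; pose i1 := widen_ord leq_card i0.
exists (\sum_(b < #|ksubsets n.+1 n| | j \notin (enum_val b : {set 'I_n.+1}))
          (S i1 b)%:C%C).
  by apply: sumr_ge0 => b _; rewrite SE mul_conjC_ge0.
transitivity (x' i1).
  rewrite (x'E i0) // /Ck enum_rankK_in //.
  by apply: eq_bigl => i; rewrite inE.
have /colP/(_ i1) := x'S; rewrite !mxE => ->.
rewrite big_distrl /= [RHS]big_mkcond; apply: eq_bigr => b _.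
rewrite !mxE /Ck; case: ifPn => [j_notin|/negPn j_in]; last first.
  by rewrite (bigD1 j) //= subrr mul0r mulr0.
congr (_ * _); have -> : enum_val b = lift j @: 'I_n :> {set 'I_n.+1}.
  apply/eqP; rewrite eqEcard card_imset; last exact: lift_inj.
  rewrite card_ord -card_ksubset leqnn andbT; apply/subsetP => x x_in.
  have [y ->|eq_xj] := unliftP j x; first exact: imset_f.
  by rewrite eq_xj (negPf j_notin) in x_in.
by rewrite big_imset //= => ? ? _ _; exact: lift_inj.
Qed.

Lemma prod_XsubC_interpolation (F : fieldType) (n : nat)
    (lambda : 'I_n.+1 -> F) (mu : 'I_n -> F) (w : 'I_n.+1 -> F) :
  injective lambda ->
  (forall j, \prod_i (mu i - lambda j) =
             w j * \prod_i (lambda (lift j i) - lambda j)) ->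
  \prod_i ('X - (mu i)%:P) =
  \sum_j w j *: \prod_(i < n) ('X - (lambda (lift j i))%:P).
Proof.
move=> inj_l wE; apply/eqP; rewrite -subr_eq0; apply/eqP.
apply: (@roots_geq_poly_eq0 _ _ (codom lambda)).
- apply/allP => _ /codomP[j ->]; rewrite /root hornerD hornerN horner_sum.
  rewrite (bigD1 j) //= [X in _ - (_ + X)]big1 => [|l neq_lj]; last first.
    have [i jE|eq_jl] := unliftP l j; last by rewrite eq_jl eqxx in neq_lj.
    rewrite hornerZ horner_prod (bigD1 i) //= hornerXsubC -jE.
    by rewrite subrr mul0r mulr0.
  rewrite addr0 hornerZ !horner_prod subr_eq0; apply/eqP.
  have oppE (G : 'I_n -> F) :
      \prod_i ('X - (G i)%:P).[lambda j] =
      (-1) ^+ n * \prod_i (G i - lambda j).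
    rewrite -[in (-1) ^+ n](card_ord n) -prodrN.
    by apply: eq_bigr => i _; rewrite hornerXsubC opprB.
  by rewrite !oppE wE mulrCA.
- by apply/injectiveP.
rewrite size_codom card_ord; apply: leq_trans (size_polyD _ _) _.
rewrite size_polyN geq_max size_prod_XsubC.
rewrite {1}/index_enum -enumT size_enum_ord leqnn /=.
apply: leq_trans (size_sum _ _ _) _; apply/bigmax_leqP => j _.
apply: leq_trans (size_scale_leq _ _) _.
by rewrite size_prod_XsubC /index_enum -enumT size_enum_ord.
Qed.

Lemma sum_interpolation_weights (F : fieldType) (n : nat)
    (lambda : 'I_n.+1 -> F) (mu : 'I_n -> F) (w : 'I_n.+1 -> F) :
  \prod_i ('X - (mu i)%:P) =
  \sum_j w j *: \prod_(i < n) ('X - (lambda (lift j i))%:P) ->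
  \sum_j w j = 1.
Proof.
have coefn (z : 'I_n -> F) : (\prod_i ('X - (z i)%:P))`_n = 1.
  have := monicP (monic_prod_XsubC (index_enum 'I_n) xpredT z).
  by rewrite lead_coefE size_prod_XsubC /index_enum -enumT size_enum_ord.
move=> /(congr1 (fun p : {poly F} => p`_n)); rewrite coefn coef_sum => ->.
by apply: eq_bigr => j _; rewrite coefZ coefn mulr1.
Qed.

Lemma char_poly_principal_unitary (R : realType) (n : nat)
    (U : 'M[R[i]]_n.+1) (lambda : 'I_n.+1 -> R[i]) :
  U \is unitarymx ->
  char_poly (principal_submx (U *m diag_mx (\row_j lambda j) *m U^t*)) =
  \sum_j (U ord_max j * (U ord_max j)^*) *:
    \prod_(i < n) ('X - (lambda (lift j i))%:P).
Proof.
move=> Uu; set A := _ *m _.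
have -> : char_poly (principal_submx A) =
    (\adj (char_poly_mx A)) ord_max ord_max.
  rewrite mxE /cofactor -signr_odd oddD addbb mul1r; congr determinant.
  by apply/matrixP => i j; rewrite !mxE (inj_eq lift_inj).
pose P := map_mx polyC U; pose P' := map_mx polyC (U^t*).
have PP' : P *m P' = 1%:M.
  by rewrite -map_mxM (unitarymxP Uu) map_mx1.
have P'P : P' *m P = 1%:M by exact: mulmx1C.
pose q (j : 'I_n.+1) := \prod_(i < n) ('X - (lambda (lift j i))%:P).
pose Q := P *m diag_mx (\row_j q j) *m P'.
have detA : \det (char_poly_mx A) = \prod_j ('X - (lambda j)%:P).
  rewrite -/(char_poly A) char_poly_unitary_conj //.
  rewrite char_poly_trig ?diag_mx_is_trig //.
  by apply: eq_bigr => j _; rewrite !mxE eqxx.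
have detA_neq0 : \det (char_poly_mx A) != 0.
  by rewrite detA monic_neq0 // monic_prod_XsubC.
have MQ : char_poly_mx A *m Q = (\det (char_poly_mx A))%:M.
  rewrite detA; have -> : char_poly_mx A =
      P *m diag_mx (\row_j ('X - (lambda j)%:P)) *m P'.
    have -> : diag_mx (\row_j ('X - (lambda j)%:P)) =
        'X%:M - map_mx polyC (diag_mx (\row_j lambda j)).
      apply/matrixP => i j; rewrite !mxE mulrnBl; congr (_ - _).
      by case: eqP.
    rewrite mulmxBr mulmxBl scalar_mxC -(mulmxA _ P) PP' mulmx1.
    by rewrite /char_poly_mx !map_mxM.
  rewrite /Q !mulmxA -[_ *m P' *m P]mulmxA P'P mulmx1.
  rewrite -[P *m _ *m diag_mx _]mulmxA mulmx_diag.
  have -> : (\row_j ((\row_j ('X - (lambda j)%:P)) 0 j * (\row_j q j) 0 j)) =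
      const_mx (\prod_j ('X - (lambda j)%:P)).
    by apply/rowP => j; rewrite !mxE (bigD1_ord j).
  by rewrite diag_const_mx scalar_mxC -(mulmxA _ P) PP' mulmx1.
have -> : \adj (char_poly_mx A) = Q.
  apply/matrixP => i j.
  have := congr1 (mulmx (\adj (char_poly_mx A))) MQ.
  rewrite mulmxA mul_adj_mx mul_scalar_mx mul_mx_scalar => /matrixP/(_ i j).
  by rewrite !mxE => /(mulfI detA_neq0).
rewrite mxE; apply: eq_bigr => j _.
by rewrite mul_mx_diag !mxE mulrAC -polyCM -mul_polyC.
Qed.

Lemma unitarymx_last_row (C : numClosedFieldType) (n : nat)
    (w : 'I_n.+1 -> C) :
  (forall j, 0 <= w j) -> \sum_j w j = 1 ->
  exists2 U : 'M[C]_n.+1, U \is unitarymx &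
    forall j, U ord_max j * (U ord_max j)^* = w j.
Proof.
move=> w_ge0 sum_w; pose v := \row_j sqrtC (w j).
have vE j : v 0 j * (v 0 j)^* = w j.
  by rewrite mxE -normCK -normrX sqrtCK ger0_norm.
have vu : v \is unitarymx.
  apply/unitarymxP/matrixP => i j; rewrite !ord1 !mxE -sum_w eqxx.
  by apply: eq_bigr => l _; rewrite -vE !mxE.
have [W Wu Wv] := unitarymx_completion _ _ _ _ vu.
exists (row_perm (tperm ord0 ord_max) W).
  by rewrite row_permEsub rowsub_unitary //; exact: perm_inj.
move=> j; rewrite !mxE tpermR -vE.
by have /rowP/(_ j) := Wv 0 ord0 erefl; rewrite !mxE => ->.
Qed.

Lemma normal_realizes_of_weights (R : realType) (n : nat)
    (lambda : 'I_n.+1 -> R[i]) (mu : 'I_n -> R[i]) (w : 'I_n.+1 -> R[i]) :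
  (forall j, 0 <= w j) ->
  \prod_i ('X - (mu i)%:P) =
  \sum_j w j *: \prod_(i < n) ('X - (lambda (lift j i))%:P) ->
  exists A : 'M[R[i]]_n.+1, normal_realizes A lambda mu.
Proof.
move=> w_ge0 muE.
have sum_w := sum_interpolation_weights _ _ _ _ _ muE.
have [U Uu wE] := unitarymx_last_row _ _ _ w_ge0 sum_w.
exists (U *m diag_mx (\row_j lambda j) *m U^t*); split.
- apply/orthomx_spectral_subproof.
  exists (U^t*, \row_j lambda j); rewrite /= ?trmxC_unitary //.
  by rewrite invmx_unitary ?trmxC_unitary // trmxCK.
- rewrite /has_spectrum char_poly_unitary_conj //.
  rewrite char_poly_trig ?diag_mx_is_trig //.
  by apply: eq_bigr => j _; rewrite !mxE eqxx.
rewrite /has_spectrum char_poly_principal_unitary // muE.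
by apply: eq_bigr => j _; rewrite wE.
Qed.

(* The order n of the matrix is written n.+1 here.  Sufficiency fails when
   lambda has repeated entries (for instance lambda = (0,0,0), mu = (0,1)):
   there {lambda_1, ..., lambda_n} is a set of n distinct numbers. *)
Theorem theorem3p7 (R : realType) (n : nat)
    (lambda : 'I_n.+1 -> R[i]) (mu : 'I_n -> R[i]) :
  ((exists A : 'M[R[i]]_n.+1, normal_realizes A lambda mu) ->
     forall (alpha : R[i]) (k : nat), (1 <= k <= n)%N ->
       Ck_uds lambda mu alpha k)
  /\
  (injective lambda ->
   (forall j : 'I_n.+1, Ck_uds lambda mu (lambda j) n) ->
     exists A : 'M[R[i]]_n.+1, normal_realizes A lambda mu).
Proof.
split=> [[A realA] alpha k _|inj_l uds_l].
  exact: normal_realizes_Ck_uds realA.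
have /fin_all_exists2[w w_ge0 wE] := fun j => Ck_uds_weight _ _ _ _ j (uds_l j).
apply: normal_realizes_of_weights w_ge0 _.
exact: prod_XsubC_interpolation inj_l wE.
Qed.
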